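(* Fix an integer $k\geq 3$ and let $A_n,\bar A_n$ be the antiregular $k$-hypergraphs defined in the context. Put $j_0=k-1$ and $m_0=k$ if $k$ is odd, and $j_0=k$, $m_0=k-1$ if $k$ is even. (i) Suppose real numbers $\alpha_i^{(m)}$ ($0\le i\le k-1$, $m$ even, $m\ge j_0$) satisfy, for every even $m\geq j_0$, $\alpha_0^{(m)}=\alpha_0^{(m+2)}$, $\alpha_i^{(m)}+\alpha_{i-1}^{(m)}-\alpha_i^{(m+2)}=\binom{m+1}{i-1}$ for $1\le i\le k-1$, and $\alpha_{k-1}^{(m)}=\binom{m}{k-2}$. Then for every integer $n\geq \frac{k+1}{2}$: if $k$ is odd, $$I(A_{2n-1};x)=(1+x)^{n-1-\frac{k-1}{2}}\Big[(1+x)^{k-1}+\sum_{i=0}^{k-1}\alpha_i^{(k-1)}x^i\Big]-\sum_{i=0}^{k-1}\alpha_i^{(2n-2)}x^i+\sum_{i=1}^{k-1}\binom{2n-2}{i-1}x^i,$$ $$I(\bar A_{2n};x)=(1+x)^{n-\frac{k-1}{2}}\Big[(1+x)^{k-1}+\sum_{i=0}^{k-1}\alpha_i^{(k-1)}x^i\Big]-\sum_{i=0}^{k-1}\alpha_i^{(2n)}x^i;$$ if $k$ is even, $$I(A_{2n-1};x)=(1+x)^{n-1-\frac{k}{2}}\Big[(1+x)^{k}+\sum_{i=0}^{k-1}\alpha_i^{(k)}x^i\Big]-\sum_{i=0}^{k-1}\alpha_i^{(2n-2)}x^i+\sum_{i=1}^{k-1}\binom{2n-2}{i-1}x^i,$$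 $$I(\bar A_{2n};x)=(1+x)^{n-\frac{k}{2}}\Big[(1+x)^{k}+\sum_{i=0}^{k-1}\alpha_i^{(k)}x^i\Big]-\sum_{i=0}^{k-1}\alpha_i^{(2n)}x^i.$$ (ii) Suppose real numbers $\beta_i^{(m)}$ ($0\le i\le k-1$, $m$ odd, $m\ge m_0$) satisfy, for every odd $m\ge m_0$, $\beta_0^{(m)}=\beta_0^{(m+2)}$, $\beta_i^{(m)}+\beta_{i-1}^{(m)}-\beta_i^{(m+2)}=\binom{m+1}{i-1}$ for $1\le i\le k-1$, and $\beta_{k-1}^{(m)}=\binom{m}{k-2}$. Then for every integer $n\ge\frac{k+1}{2}$: if $k$ is odd, $$I(\bar A_{2n-1};x)=(1+x)^{n-1-\frac{k-1}{2}}\Big[(1+x)^{k}+\sum_{i=0}^{k-1}\beta_i^{(k)}x^i\Big]-\sum_{i=0}^{k-1}\beta_i^{(2n-1)}x^i,$$ $$I(A_{2n};x)=(1+x)^{n-1-\frac{k-1}{2}}\Big[(1+x)^{k}+\sum_{i=0}^{k-1}\beta_i^{(k)}x^i\Big]-\sum_{i=0}^{k-1}\beta_i^{(2n-1)}x^i+\sum_{i=1}^{k-1}\binom{2n-1}{i-1}x^i;$$ if $k$ is even, $$I(\bar A_{2n-1};x)=(1+x)^{n-\frac{k}{2}}\Big[(1+x)^{k-1}+\sum_{i=0}^{k-1}\beta_i^{(k-1)}x^i\Big]-\sum_{i=0}^{k-1}\beta_i^{(2n-1)}x^i,$$ $$I(A_{2n};x)=(1+x)^{n-\frac{k}{2}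}\Big[(1+x)^{k-1}+\sum_{i=0}^{k-1}\beta_i^{(k-1)}x^i\Big]-\sum_{i=0}^{k-1}\beta_i^{(2n-1)}x^i+\sum_{i=1}^{k-1}\binom{2n-1}{i-1}x^i.$$
   Context: All hypergraphs are $k$-uniform (every hyperedge has exactly $k$ vertices). For a binary string $b=b_1\cdots b_n$, let $H(b)$ be the $k$-uniform hypergraph on $\{1,\dots,n\}$ in which a $k$-subset is a hyperedge iff its largest element $j$ satisfies $b_j=1$ (vertices are added in order; vertex $j$ is isolated if $b_j=0$ and dominating, i.e. forms a hyperedge with every $(k-1)$-subset of earlier vertices, if $b_j=1$). For $1\le n\le k-1$, $A_n=\bar A_n$ is the edgeless hypergraph on $n$ vertices. For $n\ge k$, $A_n=H(b)$ with $b$ of length $n$, $b_1=\dots=b_{k-1}=0$, $b_k,\dots,b_n$ alternating, and $b_n=1$; $\bar A_n$ is the same with $b_n=0$. A vertex set is independent if it contains no hyperedge, and $I(H;x)=\sum_{W\text{ independent}}x^{|W|}$. The superscript $(m)$ on $\alpha,\beta$ is an index, not a power. *)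

(* Defs.v *)
From HB Require Import structures.
From mathcomp Require Import all_boot all_order all_algebra.
From mathcomp Require Import reals.

Set Implicit Arguments.
Unset Strict Implicit.
Unset Printing Implicit Defensive.

Import Order.TTheory GRing.Theory Num.Theory.
Local Open Scope ring_scope.

Record uhypergraph (k : nat) (V : finType) := UHypergraph {
  hedges : {set {set V}};
  hedges_uniform : forall e : {set V}, e \in hedges -> #|e| = k }.

Definition independent (k : nat) (V : finType) (H : uhypergraph k V)
    (W : {set V}) : bool :=
  [forall e in hedges H, ~~ (e \subset W)].

Definition indep_poly (R : realType) (k : nat) (V : finType)
    (H : uhypergraph k V) : {poly R} :=
  \sum_(W : {set V} | independent H W) 'X^#|W|.

Fact edgeless_uniform (k : nat) (V : finType) (e : {set V}) :
  e \in set0 -> #|e| = k.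
Proof. by rewrite inE. Qed.

Definition edgeless (k : nat) (V : finType) : uhypergraph k V :=
  UHypergraph (@edgeless_uniform k V).

(* The ordinal j : 'I_n stands for the vertex j.+1 of {1, ..., n}, and
   tnth b j for the letter b_(j.+1). *)
Definition string_edges (k n : nat) (b : n.-tuple bool) : {set {set 'I_n}} :=
  [set e : {set 'I_n} | (#|e| == k) &&
     [exists j in e, [forall i in e, (i <= j)%N] && tnth b j]].

Fact string_edges_uniform (k n : nat) (b : n.-tuple bool) (e : {set 'I_n}) :
  e \in string_edges k b -> #|e| = k.
Proof. by rewrite inE => /andP[/eqP]. Qed.

Definition string_hypergraph (k n : nat) (b : n.-tuple bool) :
    uhypergraph k 'I_n :=
  UHypergraph (@string_edges_uniform k n b).

(* b_1 = ... = b_(k-1) = 0, and b_v = c (+) odd (n - v) for k <= v <= n: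
   these letters alternate and the last one, b_n, is c. *)
Definition antiregular_string (k n : nat) (c : bool) : n.-tuple bool :=
  [tuple (k <= j.+1)%N && (c (+) odd (n - j.+1)) | j < n].

Definition antiregular (k n : nat) : uhypergraph k 'I_n :=
  if (n < k)%N then edgeless k 'I_n
  else string_hypergraph k (antiregular_string k n true).

Definition antiregular_bar (k n : nat) : uhypergraph k 'I_n :=
  if (n < k)%N then edgeless k 'I_n
  else string_hypergraph k (antiregular_string k n false).

Definition j0 (k : nat) : nat := if odd k then k.-1 else k.
Definition m0 (k : nat) : nat := if odd k then k else k.-1.

(* Main.v *)
(** Splitting the vertex subsets of an (n+1)-vertex hypergraph according to
    whether they contain the last vertex shows that an isolated last vertex
    multiplies the independence polynomial by [1 + X], while a dominating one
    adds [S_n = \sum_(1 <= i < k) 'C(n, i - 1) X^i].  Hence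
    [I(bar A_(m+2)) = (1 + X) (I(bar A_m) + S_m)], and the conditions on alpha and
    beta say exactly that the polynomials [a^(m)] with these coefficients satisfy
    [a^(m+2) = (1 + X) (a^(m) - S_m)].  So [I(bar A_m) + a^(m)] is multiplied by
    [1 + X] at each step, starting from an edgeless hypergraph. *)
Require Import Defs.
From HB Require Import structures.
From mathcomp Require Import all_boot all_order all_algebra.
From mathcomp Require Import reals.
From mathcomp Require Import zify.

Set Implicit Arguments.
Unset Strict Implicit.
Unset Printing Implicit Defensive.

Import Order.TTheory GRing.Theory Num.Theory.
Local Open Scope ring_scope.

(** * Antiregular hypergraphs as string hypergraphs *)

Lemma indep_poly_eq_edges (R : realType) (k : nat) (V : finType)
    (G H : uhypergraph k V) :
  hedges G = hedges H -> indep_poly R G = indep_poly R H.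
Proof. by move=> eqGH; apply: eq_bigl => W; rewrite /independent eqGH. Qed.

Lemma string_edges_small (k n : nat) (b : n.-tuple bool) :
  (n < k)%N -> string_edges k b = set0.
Proof.
move=> n_lt_k; apply/setP=> e; rewrite !inE; apply/negbTE/nandP; left.
rewrite neq_ltn; apply/orP; left; apply: leq_ltn_trans n_lt_k.
by rewrite -[leqRHS]card_ord max_card.
Qed.

(** Below k vertices the string hypergraph has no edges either, so the case distinction in the
    definition disappears and letters can be appended uniformly in n. *)
Lemma indep_poly_antiregular (R : realType) (k n : nat) :
  indep_poly R (antiregular k n)
    = indep_poly R (string_hypergraph k (antiregular_string k n true)).
Proof.
rewrite /antiregular; case: ifP => // n_lt_k.
by apply: indep_poly_eq_edges; rewrite /= string_edges_small.
Qed.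

Lemma indep_poly_antiregular_bar (R : realType) (k n : nat) :
  indep_poly R (antiregular_bar k n)
    = indep_poly R (string_hypergraph k (antiregular_string k n false)).
Proof.
rewrite /antiregular_bar; case: ifP => // n_lt_k.
by apply: indep_poly_eq_edges; rewrite /= string_edges_small.
Qed.

Lemma indep_poly_edgeless (R : realType) (k n : nat) :
  indep_poly R (edgeless k 'I_n) = (1 + 'X) ^+ n.
Proof.
(* Expand the product of n factors X + 1 over the set of vertices that contribute X. *)
rewrite addrC -[in RHS](card_ord n) -prodr_const bigA_distr.
apply: eq_big => [W | W _]; first by apply/forall_inP=> e; rewrite inE.
by rewrite -big_mkcond /= prodr_const.
Qed.

Lemma nth_antiregular_string (k n i : nat) (c : bool) :
  (i < n)%N ->
  nth false (antiregular_string k n c) i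
    = (k <= i.+1)%N && (c (+) odd (n - i.+1)).
Proof.
move=> lt_in; rewrite -[i in LHS]/(val (Ordinal lt_in)) -tnth_nth.
by rewrite tnth_mktuple.
Qed.

(** Letters depend on the distance to the end of the string, so deleting the last one flips the
    parameter [c]. *)
Lemma antiregular_string_rcons (k n : nat) (c : bool) :
  antiregular_string k n.+1 c
    = rcons_tuple (antiregular_string k n (~~ c)) ((k <= n.+1)%N && c)
    :> seq bool.
Proof.
apply: (@eq_from_nth _ false) => [|i]; rewrite size_tuple.
  by rewrite size_rcons size_tuple.
move=> lt_iSn; rewrite nth_rcons size_tuple nth_antiregular_string //.
case: (ltngtP i n) => [lt_in | gt_in | ->]; last by rewrite subnn addbF.
  by rewrite nth_antiregular_string // subSn // oddS addbN addNb.
by rewrite ltnS leqNgt gt_in in lt_iSn.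
Qed.

(** * Appending a last vertex to a string hypergraph *)

Section AddVertex.
Variables (n : nat).
Implicit Types (V : {set 'I_n}) (b : n.-tuple bool) (c : bool).

(** With [lift ord_max] as the inclusion of the old vertices, [unliftP] separates them from the new
    one. *)
Let widen : 'I_n -> 'I_n.+1 := lift ord_max.

Definition widen_set V : {set 'I_n.+1} := widen @: V.

Lemma widen_inj : injective widen. Proof. exact: lift_inj. Qed.

Lemma max_neq_widen (i : 'I_n) : (ord_max == widen i) = false.
Proof. exact/negbTE/neq_lift. Qed.

Lemma val_widen (i : 'I_n) : widen i = i :> nat.
Proof. exact: lift_max. Qed.

Lemma widen_setK : cancel widen_set (fun W => widen @^-1: W).
Proof. by move=> V; apply/setP=> i; rewrite inE mem_imset //; apply: widen_inj. Qed.

Lemma max_notin_widen V : ord_max \notin widen_set V.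
Proof. by apply/imsetP=> -[i _ /eqP]; rewrite max_neq_widen. Qed.

Lemma widen_preimset (W : {set 'I_n.+1}) :
  widen_set (widen @^-1: W) = W :\ ord_max.
Proof.
apply/setP=> j; rewrite in_setD1; case: (unliftP ord_max j) => [i|] ->.
  by rewrite mem_imset ?inE 1?eq_sym ?max_neq_widen //; apply: widen_inj.
by rewrite eqxx; apply: negPf; apply: max_notin_widen.
Qed.

Lemma preimset_widenK (W : {set 'I_n.+1}) :
  ord_max \notin W -> widen_set (widen @^-1: W) = W.
Proof.
move=> maxW; rewrite widen_preimset; apply/setDidPl.
by rewrite disjoint_sym disjoints1.
Qed.

Lemma card_widen_set V : #|widen_set V| = #|V|.
Proof. exact: card_imset widen_inj. Qed.

Lemma sum_set_ord_recr (R : nmodType) (P : pred {set 'I_n.+1})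
    (F : {set 'I_n.+1} -> R) :
  \sum_(W | P W) F W
    = \sum_(V | P (widen_set V)) F (widen_set V)
      + \sum_(V | P (ord_max |: widen_set V)) F (ord_max |: widen_set V).
Proof.
rewrite (bigID (fun W : {set 'I_n.+1} => ord_max \in W)) /= addrC.
congr (_ + _).
  rewrite (reindex_onto widen_set (fun W => widen @^-1: W)) /=.
    by apply: eq_bigl => V; rewrite max_notin_widen widen_setK eqxx !andbT.
  by move=> W /andP[_ maxW]; apply: preimset_widenK.
rewrite (reindex_onto (fun V => ord_max |: widen_set V)
           (fun W => widen @^-1: W)) /=.
  apply: eq_bigl => V; rewrite setU11 andbT; case: (P _) => //=.
  apply/eqP/setP=> i; rewrite !inE eq_sym max_neq_widen /=.
  by rewrite mem_imset //; apply: widen_inj.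
by move=> W /andP[_ maxW]; rewrite widen_preimset setD1K.
Qed.

Lemma tnth_rcons_widen b c (i : 'I_n) :
  tnth (rcons_tuple b c) (widen i) = tnth b i.
Proof.
by rewrite !(tnth_nth false) val_widen /= nth_rcons size_tuple ltn_ord.
Qed.

Lemma tnth_rcons_max b c : tnth (rcons_tuple b c) ord_max = c.
Proof. by rewrite (tnth_nth false) /= nth_rcons size_tuple ltnn eqxx. Qed.

Lemma string_edge_widen (k : nat) b c V :
  (widen_set V \in string_edges k (rcons_tuple b c)) = (V \in string_edges k b).
Proof.
rewrite !inE card_widen_set; congr (_ && _).
apply/exists_inP/exists_inP => [[_ /imsetP[j jV ->]] | [j jV]].
  rewrite tnth_rcons_widen => /andP[/forall_inP jmax bj]; exists j => //.
  rewrite bj andbT; apply/forall_inP => i iV.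
  by rewrite -!val_widen; apply: jmax; apply: imset_f.
move=> /andP[/forall_inP jmax bj]; exists (widen j); first exact: imset_f.
rewrite tnth_rcons_widen bj andbT.
by apply/forall_inP => _ /imsetP[i iV ->]; rewrite !val_widen jmax.
Qed.

(** The largest vertex of such a set is [ord_max], so only its letter [c] matters. *)
Lemma string_edge_max (k : nat) b c (e : {set 'I_n.+1}) :
  ord_max \in e ->
  (e \in string_edges k (rcons_tuple b c)) = (#|e| == k) && c.
Proof.
move=> maxe; rewrite inE; congr (_ && _).
apply/exists_inP/idP => [[j _ /andP[/forall_inP/(_ _ maxe)]] | cT].
  move=> max_le_j; suff -> : j = ord_max by rewrite tnth_rcons_max.
  by apply/val_inj/eqP; rewrite eqn_leq max_le_j -ltnS ltn_ord.
exists ord_max => //; rewrite tnth_rcons_max cT andbT.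
by apply/forall_inP=> i _; rewrite -ltnS.
Qed.

(** An edge inside [widen_set V] avoids [ord_max], hence is the image of an edge inside [V]. *)
Lemma independent_widen (k : nat) b c V :
  independent (string_hypergraph k (rcons_tuple b c)) (widen_set V)
    = independent (string_hypergraph k b) V.
Proof.
apply/forall_inP/forall_inP => indV e /= eE.
  have := indV (widen_set e); rewrite /= string_edge_widen => /(_ eE).
  by apply: contra; apply: imsetS.
apply/negP=> sub_eV; have max_e : ord_max \notin e.
  by apply: contra (max_notin_widen V); apply: (subsetP sub_eV).
have eqe : widen_set (widen @^-1: e) = e.
  exact: preimset_widenK.
apply: (negP (indV (widen @^-1: e) _)).
  by rewrite /= -(string_edge_widen k b c) eqe.
by rewrite -(widen_setK V); apply: preimsetS.
Qed.

(** With last letter [false] no edge contains [ord_max], so adding it to a set captures no new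
    edge. *)
Lemma independent_isolated (k : nat) b V :
  independent (string_hypergraph k (rcons_tuple b false)) (ord_max |: widen_set V)
    = independent (string_hypergraph k b) V.
Proof.
rewrite -(independent_widen k b false).
apply/forall_inP/forall_inP => indV e /= eE.
  by apply: contra (indV e eE) => /subset_trans; apply; apply: subsetUr.
apply/negP => sub_eV; have max_e : ord_max \notin e.
  by apply/negP=> max_e; move: eE; rewrite string_edge_max // andbF.
apply: (negP (indV e eE)); apply/subsetP=> i ie.
have /setU1P[eq_i|//] := subsetP sub_eV i ie.
by rewrite -eq_i ie in max_e.
Qed.

(** Any k old vertices form an edge with the new one; with fewer than k old vertices the whole set
    is too small to contain an edge of size k + 1. *)
Lemma independent_dominating (k : nat) b V :
  independent (string_hypergraph k.+1 (rcons_tuple b true))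
    (ord_max |: widen_set V) = (#|V| < k)%N.
Proof.
apply/forall_inP/idP => [indV | ltVk e /string_edges_uniform card_e].
  rewrite ltnNge; apply/negP=> /card_geqP[s [uniq_s size_s sub_s]].
  set U : {set 'I_n} := [set x in s].
  have cardU : #|U| = k by rewrite cardsE (card_uniqP uniq_s).
  apply: (negP (indV (ord_max |: widen_set U) _)).
    by rewrite /= string_edge_max ?setU11 // cardsU1 max_notin_widen
      card_widen_set cardU andbT.
  by apply/setUS/imsetS/subsetP=> x; rewrite inE; apply: sub_s.
apply/negP=> /subset_leq_card.
by rewrite card_e cardsU1 max_notin_widen card_widen_set ltnNge ltVk.
Qed.

Lemma indep_poly_isolated (R : realType) (k : nat) b :
  indep_poly R (string_hypergraph k (rcons_tuple b false))
    = (1 + 'X) * indep_poly R (string_hypergraph k b).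
Proof.
rewrite /indep_poly sum_set_ord_recr mulrDl mul1r big_distrr; congr (_ + _).
  by apply: eq_big => V; rewrite ?independent_widen // card_widen_set.
apply: eq_big => V; rewrite ?independent_isolated // => _.
by rewrite cardsU1 max_notin_widen card_widen_set exprS.
Qed.

Lemma sum_small_sets (R : nzRingType) (k : nat) :
  \sum_(V : {set 'I_n} | (#|V| < k)%N) ('X : {poly R}) ^+ #|V|.+1
    = \sum_(1 <= i < k.+1) 'C(n, i - 1)%:R *: 'X^i.
Proof.
rewrite big_add1 big_mkord /=.
(* The inner sum has one term if #|V| < k and none otherwise; exchanging the sums then groups the
   sets by size. *)
transitivity (\sum_(V : {set 'I_n}) \sum_(i < k | i == #|V| :> nat)
                ('X : {poly R}) ^+ i.+1).
  rewrite big_mkcond; apply: eq_bigr => V _.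
  by rewrite (big_ord1_eq _ (fun i => 'X ^+ i.+1)).
rewrite (exchange_big_dep predT) //=; apply: eq_bigr => i _.
rewrite sumr_const subn1 /= scaler_nat; congr (_ *+ _).
rewrite -[in RHS](card_ord n) -card_draws cardsE.
by apply: eq_card => V; apply: eq_sym.
Qed.

Lemma indep_poly_dominating (R : realType) (k : nat) b :
  (0 < k)%N ->
  indep_poly R (string_hypergraph k (rcons_tuple b true))
    = indep_poly R (string_hypergraph k b)
      + \sum_(1 <= i < k) 'C(n, i - 1)%:R *: 'X^i.
Proof.
case: k => // k _; rewrite /indep_poly sum_set_ord_recr; congr (_ + _).
  by apply: eq_big => V; rewrite ?independent_widen // card_widen_set.
rewrite -sum_small_sets; apply: eq_big => V; rewrite ?independent_dominating //.
by rewrite cardsU1 max_notin_widen card_widen_set.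
Qed.

End AddVertex.

(** * One-step recurrences and initial values *)

Lemma indep_poly_antiregular_barS (R : realType) (k n : nat) :
  indep_poly R (antiregular_bar k n.+1)
    = (1 + 'X) * indep_poly R (antiregular k n).
Proof.
rewrite indep_poly_antiregular_bar indep_poly_antiregular.
rewrite (val_inj (antiregular_string_rcons k n false)) andbF.
exact: indep_poly_isolated.
Qed.

(** The bound k <= n + 1 is what makes the appended letter [true]. *)
Lemma indep_poly_antiregularS (R : realType) (k n : nat) :
  (0 < k <= n.+1)%N ->
  indep_poly R (antiregular k n.+1)
    = indep_poly R (antiregular_bar k n)
      + \sum_(1 <= i < k) 'C(n, i - 1)%:R *: 'X^i.
Proof.
case/andP=> k_gt0 le_kn.
rewrite indep_poly_antiregular_bar indep_poly_antiregular.
rewrite (val_inj (antiregular_string_rcons k n true)) le_kn.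
exact: indep_poly_dominating.
Qed.

(** The case n = k is included because the recurrence may start there: its last vertex is isolated
    over an edgeless hypergraph. *)
Lemma indep_poly_antiregular_bar_small (R : realType) (k n : nat) :
  (n <= k)%N -> indep_poly R (antiregular_bar k n) = (1 + 'X) ^+ n.
Proof.
have edgeless_bar m : (m < k)%N ->
    indep_poly R (antiregular_bar k m) = (1 + 'X) ^+ m.
  by move=> lt_mk; rewrite /antiregular_bar lt_mk indep_poly_edgeless.
rewrite leq_eqVlt => /predU1P[->|]; last exact: edgeless_bar.
case: k edgeless_bar => [_|k _].
  (* For k = n = 0 the definition takes the string branch, but an edge would need a largest vertex
     and there are no vertices. *)
  rewrite indep_poly_antiregular_bar -(indep_poly_edgeless R 0 0).
  apply: indep_poly_eq_edges; apply/setP=> e; rewrite !inE.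
  by apply/negbTE/nandP; right; apply/exists_inP=> -[[]].
rewrite indep_poly_antiregular_barS /antiregular ltnSn.
by rewrite indep_poly_edgeless exprS.
Qed.

(** * The correction polynomials and their recurrence *)

Definition correction (R : realType) (k : nat) (a : nat -> R) : {poly R} :=
  \sum_(0 <= i < k) a i *: 'X^i.

Lemma coef_correction (R : realType) (k : nat) (a : nat -> R) (i : nat) :
  (correction k a)`_i = if (i < k)%N then a i else 0.
Proof. by rewrite /correction big_mkord -(poly_def k a) coef_poly. Qed.

Lemma coef_binomial_sum (R : realType) (k m i : nat) :
  (\sum_(1 <= i < k) 'C(m, i - 1)%:R *: 'X^i : {poly R})`_i
    = if (0 < i < k)%N then 'C(m, i - 1)%:R else 0.
Proof.
have -> : \sum_(1 <= i < k) 'C(m, i - 1)%:R *: 'X^i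
    = correction k (fun i => if (0 < i)%N then 'C(m, i - 1)%:R else 0) :> {poly R}.
  rewrite /correction; case: k => [|k]; first by rewrite !big_geq.
  rewrite [in RHS]big_ltn //= scale0r add0r.
  by apply: eq_big_nat => j /andP[j_gt0 _]; rewrite j_gt0.
by rewrite coef_correction; case: (ltnP i k); rewrite ?andbT ?andbF.
Qed.

(* The last condition kills the coefficient of [X^k] in the product. *)
Lemma correction_step (R : realType) (k m : nat) (a a' : nat -> R) :
  (1 < k)%N ->
  a 0%N = a' 0%N ->
  (forall i, (1 <= i <= k - 1)%N ->
     a i + a (i - 1)%N - a' i = 'C(m + 1, i - 1)%:R) ->
  a (k - 1)%N = 'C(m, k - 2)%:R ->
  correction k a'
    = (1 + 'X) * (correction k a - \sum_(1 <= i < k) 'C(m, i - 1)%:R *: 'X^i).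
Proof.
case: k => [|[|k]] // _ eq0 eqS eq_top; apply/polyP=> i.
rewrite mulrDl mul1r coefD coefXM !coefB !coef_correction !coef_binomial_sum.
case: i => [|i] /=; first by rewrite eq0 subr0 addr0.
rewrite !subn1 /= !ltnS; case: (ltngtP i k.+1) => [lt_ik|gt_ik|->].
- have:= eqS i.+1; rewrite !subn1 /= => /(_ lt_ik) eq_i.
  have -> : a' i.+1 = a i.+1 + a i - 'C(m + 1, i)%:R by rewrite -eq_i subKr.
  rewrite -ltnS lt_ik andbT.
  (* Pascal's rule merges the binomials from the factors 1 and X; for i = 0 the second is absent, as
     the binomial sum has no constant term. *)
  case: i {lt_ik eq_i} => [|i] /=; first by rewrite !bin0 subr0 addrAC.
  by rewrite addn1 binS natrD opprD addrACA.
- by rewrite leqNgt (ltnW gt_ik) andbF !subr0 addr0.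
- by move: eq_top; rewrite !subSS !subn0 ltnn => ->; rewrite !subrr addr0.
Qed.

(** * Closed forms along one parity class *)

Section Recurrence.
Variables (R : realType) (k p : nat) (a : nat -> nat -> R).
Hypotheses (k_gt1 : (1 < k)%N) (p_range : (k.-1 <= p <= k)%N).
(** This covers both families: [p] is the even one of k - 1 and k for alpha, the odd one for
    beta. *)
Hypothesis a_rec : forall m : nat, odd m = odd p -> (p <= m)%N ->
  [/\ a m 0%N = a (m + 2)%N 0%N,
      forall i : nat, (1 <= i <= k - 1)%N ->
        a m i + a m (i - 1)%N - a (m + 2)%N i = 'C(m + 1, i - 1)%:R
    & a m (k - 1)%N = 'C(m, k - 2)%:R].

(** Induction on [d]: the bound p <= k gives the initial value, and k - 1 <= p makes the first
    vertex added in each double step dominating. *)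
Lemma indep_poly_antiregular_bar_closed (m d : nat) :
  m = (p + d * 2)%N ->
  indep_poly R (antiregular_bar k m)
    = (1 + 'X) ^+ d * ((1 + 'X) ^+ p + correction k (a p))
      - correction k (a m).
Proof.
move=> ->; have [le_kp le_pk] := andP p_range; elim: d => [|d IHd].
  by rewrite mul0n addn0 indep_poly_antiregular_bar_small // mul1r addrK.
rewrite mulSn addnCA; set m' := (p + d * 2)%N in IHd *.
have [|| a0 aS atop] := a_rec (m := m'); rewrite ?leq_addr //.
  by rewrite /m' oddD muln2 odd_double addbF.
rewrite indep_poly_antiregular_barS indep_poly_antiregularS; last first.
  by rewrite (ltnW k_gt1) -(prednK (ltnW k_gt1)) ltnS (leq_trans le_kp) ?leq_addr.
rewrite IHd -[(2 + m')%N]addnC.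
rewrite (correction_step k_gt1 a0 aS atop) exprS -mulrA -mulrBr.
by congr (_ * _); rewrite opprB addrA addrAC.
Qed.

(** One more dominating vertex is appended to the previous closed form. *)
Lemma indep_poly_antiregular_closed (m d : nat) :
  m = (p + d * 2).+1 ->
  indep_poly R (antiregular k m)
    = (1 + 'X) ^+ d * ((1 + 'X) ^+ p + correction k (a p))
      - correction k (a m.-1)
      + \sum_(1 <= i < k) 'C(m.-1, i - 1)%:R *: 'X^i.
Proof.
move=> ->; have [le_kp _] := andP p_range.
rewrite indep_poly_antiregularS ?(indep_poly_antiregular_bar_closed erefl) //.
by rewrite (ltnW k_gt1) -(prednK (ltnW k_gt1)) ltnS (leq_trans le_kp) ?leq_addr.
Qed.

End Recurrence.

Theorem theorem2p4 (R : realType) (k : nat) (hk : (3 <= k)%N) :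
  (forall alpha : nat -> nat -> R,
    (forall m : nat, ~~ odd m -> (j0 k <= m)%N ->
      [/\ alpha m 0%N = alpha (m + 2)%N 0%N,
          forall i : nat, (1 <= i <= k - 1)%N ->
            alpha m i + alpha m (i - 1)%N - alpha (m + 2)%N i
              = 'C(m + 1, i - 1)%:R
        & alpha m (k - 1)%N = 'C(m, k - 2)%:R]) ->
    forall n : nat, (k + 1 <= 2 * n)%N ->
      (odd k ->
         indep_poly R (antiregular k (2 * n - 1))
           = (1 + 'X) ^+ (n - 1 - (k - 1) %/ 2)
               * ((1 + 'X) ^+ (k - 1)
                  + \sum_(0 <= i < k) alpha (k - 1)%N i *: 'X^i)
             - \sum_(0 <= i < k) alpha (2 * n - 2)%N i *: 'X^i
             + \sum_(1 <= i < k) 'C(2 * n - 2, i - 1)%:R *: 'X^i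
         /\
         indep_poly R (antiregular_bar k (2 * n))
           = (1 + 'X) ^+ (n - (k - 1) %/ 2)
               * ((1 + 'X) ^+ (k - 1)
                  + \sum_(0 <= i < k) alpha (k - 1)%N i *: 'X^i)
             - \sum_(0 <= i < k) alpha (2 * n)%N i *: 'X^i)
      /\
      (~~ odd k ->
         indep_poly R (antiregular k (2 * n - 1))
           = (1 + 'X) ^+ (n - 1 - k %/ 2)
               * ((1 + 'X) ^+ k
                  + \sum_(0 <= i < k) alpha k i *: 'X^i)
             - \sum_(0 <= i < k) alpha (2 * n - 2)%N i *: 'X^i
             + \sum_(1 <= i < k) 'C(2 * n - 2, i - 1)%:R *: 'X^i
         /\
         indep_poly R (antiregular_bar k (2 * n))
           = (1 + 'X) ^+ (n - k %/ 2)
               * ((1 + 'X) ^+ k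
                  + \sum_(0 <= i < k) alpha k i *: 'X^i)
             - \sum_(0 <= i < k) alpha (2 * n)%N i *: 'X^i))
  /\
  (forall beta : nat -> nat -> R,
    (forall m : nat, odd m -> (m0 k <= m)%N ->
      [/\ beta m 0%N = beta (m + 2)%N 0%N,
          forall i : nat, (1 <= i <= k - 1)%N ->
            beta m i + beta m (i - 1)%N - beta (m + 2)%N i
              = 'C(m + 1, i - 1)%:R
        & beta m (k - 1)%N = 'C(m, k - 2)%:R]) ->
    forall n : nat, (k + 1 <= 2 * n)%N ->
      (odd k ->
         indep_poly R (antiregular_bar k (2 * n - 1))
           = (1 + 'X) ^+ (n - 1 - (k - 1) %/ 2)
               * ((1 + 'X) ^+ k
                  + \sum_(0 <= i < k) beta k i *: 'X^i)
             - \sum_(0 <= i < k) beta (2 * n - 1)%N i *: 'X^i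
         /\
         indep_poly R (antiregular k (2 * n))
           = (1 + 'X) ^+ (n - 1 - (k - 1) %/ 2)
               * ((1 + 'X) ^+ k
                  + \sum_(0 <= i < k) beta k i *: 'X^i)
             - \sum_(0 <= i < k) beta (2 * n - 1)%N i *: 'X^i
             + \sum_(1 <= i < k) 'C(2 * n - 1, i - 1)%:R *: 'X^i)
      /\
      (~~ odd k ->
         indep_poly R (antiregular_bar k (2 * n - 1))
           = (1 + 'X) ^+ (n - k %/ 2)
               * ((1 + 'X) ^+ (k - 1)
                  + \sum_(0 <= i < k) beta (k - 1)%N i *: 'X^i)
             - \sum_(0 <= i < k) beta (2 * n - 1)%N i *: 'X^i
         /\
         indep_poly R (antiregular k (2 * n))
           = (1 + 'X) ^+ (n - k %/ 2)
               * ((1 + 'X) ^+ (k - 1)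
                  + \sum_(0 <= i < k) beta (k - 1)%N i *: 'X^i)
             - \sum_(0 <= i < k) beta (2 * n - 1)%N i *: 'X^i
             + \sum_(1 <= i < k) 'C(2 * n - 1, i - 1)%:R *: 'X^i)).
Proof.
(* These equations give the indices the shape [m.-1] of [indep_poly_antiregular_closed]. *)
have pred2 (n : nat) : (2 * n - 2)%N = (2 * n - 1).-1 by lia.
have pred1 (n : nat) : (2 * n - 1)%N = (2 * n).-1 by lia.
have k_gt1 : (1 < k)%N by apply: ltnW.
split=> [a | b] rec n le_kn; split=> k_par.
all: rewrite /j0 /m0 ?k_par ?(negPf k_par) in rec.
- rewrite pred2; split.
    (* Unification reads [p] and [d] off the goal; [lia] checks the index equation, where the parity
       of k makes the halving exact and k + 1 <= 2n keeps the subtractions from truncating. *)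
    apply: indep_poly_antiregular_closed => //; try lia.
    by move=> m *; apply: rec; lia.
  apply: indep_poly_antiregular_bar_closed => //; try lia.
  by move=> m *; apply: rec; lia.
- rewrite pred2; split.
    apply: indep_poly_antiregular_closed => //; try lia.
    by move=> m *; apply: rec; lia.
  apply: indep_poly_antiregular_bar_closed => //; try lia.
  by move=> m *; apply: rec; lia.
- split; last rewrite pred1.
    apply: indep_poly_antiregular_bar_closed => //; try lia.
    by move=> m *; apply: rec; lia.
  apply: indep_poly_antiregular_closed => //; try lia.
  by move=> m *; apply: rec; lia.
- split; last rewrite pred1.
    apply: indep_poly_antiregular_bar_closed => //; try lia.
    by move=> m *; apply: rec; lia.
  apply: indep_poly_antiregular_closed => //; try lia.
  by move=> m *; apply: rec; lia.
Qed.
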